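(* For all $n\ge 1$ one has $\mathrm{Tot}^{\kappa}(F_n)=F_n$.
   Context: $(F_n)_{n\ge0}=0,1,1,2,3,5,\dots$ are the Fibonacci numbers ($F_0=0$, $F_1=1$, $F_{n+1}=F_n+F_{n-1}$). Let $\varphi=(1+\sqrt5)/2$. A finite base phi expansion of a natural number $N$ is a sequence $(a_i)_{i\in\mathbb Z}$ with $a_i\in\{0,1\}$, only finitely many $a_i$ nonzero, and $N=\sum_i a_i\varphi^i$. A Knott expansion of $N$ is a finite base phi expansion $(a_i)$ of $N$ such that, if $R$ denotes the smallest index with $a_R=1$, then $a_{R+2}a_{R+1}a_R\neq 011$. The number of Knott expansions of $N$ is denoted $\mathrm{Tot}^{\kappa}(N)$. *)

(* Defs.v *)
From mathcomp Require Import all_boot all_order all_algebra finmap.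
From mathcomp Require Import boolp classical_sets functions cardinality fsbigop.
From mathcomp Require Import reals.

Set Implicit Arguments.
Unset Strict Implicit.
Unset Printing Implicit Defensive.

Import Order.TTheory GRing.Theory Num.Theory.
Local Open Scope classical_set_scope.
Local Open Scope ring_scope.

Fixpoint fib (n : nat) : nat :=
  match n with
  | 0 => 0
  | 1 => 1
  | (m.+1 as k).+1 => fib k + fib m
  end%N.

Definition phi (R : realType) : R := (1 + Num.sqrt 5) / 2.

(* The digit a_i is the boolean [a i], read as 0 or 1. *)
Definition base_phi_expansion (R : realType) (N : nat) (a : int -> bool) : Prop :=
  finite_set [set i | a i] /\
  N%:R = \sum_(i \in [set: int]) (a i)%:R * phi R ^ i.

(* For N = 0 there is no smallest index r, and the condition on the last three
   digits is vacuous. *)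
Definition knott_expansion (R : realType) (N : nat) (a : int -> bool) : Prop :=
  base_phi_expansion R N a /\
  forall r : int, a r -> (forall i : int, i < r -> a i = false) ->
    (a (r + 2), a (r + 1), a r) <> (false, true, true).

(* [fset_set] sends infinite sets to the empty one, so a nonzero value of
   [Tot_kappa] also asserts that there are finitely many Knott expansions. *)
Definition Tot_kappa (R : realType) (N : nat) : nat :=
  #|` fset_set [set a : int -> bool | knott_expansion R N a] |%fset.

(* Main.v *)
Require Import Defs.
From mathcomp Require Import all_boot all_order all_algebra finmap.
From mathcomp Require Import boolp classical_sets functions cardinality fsbigop.
From mathcomp Require Import reals.
From mathcomp Require Import ring lra zify.

(** Multiplying by a power of phi turns an expansion of N whose digits live at
positions at least -m into a word of bits, least significant first, whose
value is N phi^m.  Two facts about words carry the proof.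

Counting. For n >= 2 the greedy word for F_n phi^m has its leading 1 at
position c = n + m - 2, and since F_(n+2) phi^(m+2) = F_n phi^m + phi^(n+m+2),
the leading digit moves up by four positions from (n, m) to (n + 2, m + 2). A
leading 1 is either kept or replaced by 011, and the latter can be repeated on
its lowest 1; so the number A of words of value F_n phi^m, and the number q of
those using only positions below c, follow the rules q' = A + q and A' = A + q'
([nwords_scaled_fib_step]). These rules are linear and are those of a double
step of the Fibonacci recurrence, so that the increments of (q, A) caused by
two more places after the radix point, which are (F_0, F_1) for n = 1 and (F_1,
F_2) for n = 2, are (F_(n-1), F_n) in general ([nwords_scaled_fib]).

Knott words.  An expansion violates the Knott condition exactly when it arises
from another expansion by replacing the lowest digit 1 with 011.  That other expansion
ends two places higher, so the number of Knott expansions using positions at least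
-m-2 is the number of all expansions doing so, minus the number of expansions
using positions at least -m ([size_knott_words]).  By the first fact this
difference is F_n as soon as m >= n.

Finally, the Knott expansions using positions at least -m increase with m and
their number does not depend on m, so that they are all the Knott expansions
([knott_words_pad], [knott_expansionsE]). *)

Set Implicit Arguments.
Unset Strict Implicit.
Unset Printing Implicit Defensive.

Import Order.TTheory GRing.Theory Num.Theory.
Local Open Scope classical_set_scope.
Local Open Scope ring_scope.

(** * Powers of the golden mean *)

Section Words.
Variable R : realType.
Local Notation φ := (phi R).

Lemma phi_sqr : φ ^+ 2 = φ + 1.
Proof.
have h5 : Num.sqrt (5 : R) ^+ 2 = 5 by rewrite sqr_sqrtr.
by rewrite /phi; field: h5.
Qed.

Lemma phi_gt1 : 1 < φ.
Proof.
have : Num.sqrt (1 : R) < Num.sqrt 5 by rewrite ltr_sqrt; lra.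
by rewrite sqrtr1 /phi; lra.
Qed.

Lemma phi_lt2 : φ < 2.
Proof.
have h : Num.sqrt (5 : R) < Num.sqrt (3 ^+ 2) by rewrite ltr_sqrt; lra.
by move: h; rewrite sqrtr_sqr ger0_norm // /phi; lra.
Qed.

Lemma phi_gt0 : 0 < φ.
Proof. exact: lt_trans phi_gt1. Qed.

Lemma phiX_gt0 k : 0 < φ ^+ k.
Proof. by rewrite exprn_gt0 ?phi_gt0. Qed.

Lemma phiXSS k : φ ^+ k.+2 = φ ^+ k.+1 + φ ^+ k.
Proof. rewrite -addn2 exprD phi_sqr exprS; ring. Qed.

Lemma phiX_ltS k : φ ^+ k < φ ^+ k.+1.
Proof. by rewrite ltr_eXn2l // phi_gt1. Qed.

Lemma phiX_le j k : (j <= k)%N -> φ ^+ j <= φ ^+ k.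
Proof. by move=> h; rewrite ler_weXn2l // ltW // phi_gt1. Qed.

(** * Words and their values *)

Fixpoint word_val (w : seq bool) : R :=
  if w is b :: w' then b%:R + φ * word_val w' else 0.

Lemma word_val_rcons w b :
  word_val (rcons w b) = word_val w + b%:R * φ ^+ size w.
Proof.
elim: w => [|c w IH] /=; first by rewrite expr0; ring.
rewrite IH exprS; ring.
Qed.

Lemma word_val_cat w z :
  word_val (w ++ z) = word_val w + φ ^+ size w * word_val z.
Proof.
elim: w => [|c w IH] /=; first by rewrite expr0; ring.
rewrite IH exprS; ring.
Qed.

Lemma word_val_nseq0 k : word_val (nseq k false) = 0.
Proof. by elim: k => //= k ->; ring. Qed.

Lemma word_val_ge0 w : 0 <= word_val w.
Proof.
elim: w => //= b w IH.
by apply: addr_ge0; [exact: ler0n | apply: mulr_ge0 IH; exact: ltW phi_gt0].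
Qed.

(** The recursion is on the highest digit because the value left over for
the other digits can then be compared with the largest value they can reach. *)
Fixpoint words_of (L : nat) (x : R) : seq (seq bool) :=
  if L is L'.+1 then
    [seq rcons w false | w <- words_of L' x] ++
    [seq rcons w true | w <- words_of L' (x - φ ^+ L')]
  else if x == 0 then [:: [::]] else [::].

Lemma mem_words_of L x w :
  (w \in words_of L x) = (size w == L) && (word_val w == x).
Proof.
elim: L x w => [|L IH] x w /=.
  case: w => [|b w] /=; last by case: ifP.
  by rewrite eq_sym; case: ifP.
rewrite mem_cat; case: (lastP w) => [|{}w b].
  by apply/negbTE; rewrite negb_or; apply/andP; split; apply/mapP => -[[|? ?]].
have mem_rcons c (s : seq (seq bool)) :
    (rcons w b \in [seq rcons u c | u <- s]) = (b == c) && (w \in s).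
  apply/mapP/andP => [[u us /rcons_inj [-> ->]]|[/eqP-> ws]]; last by exists w.
  by rewrite eqxx.
rewrite !mem_rcons !IH size_rcons eqSS word_val_rcons.
case: b {mem_rcons} => /=; last by rewrite mul0r addr0 orbF.
by case: eqP => //= ->; rewrite mul1r eq_sym subr_eq eq_sym.
Qed.

Lemma uniq_words_of L x : uniq (words_of L x).
Proof.
elim: L x => [|L IH] x /=; first by case: ifP.
rewrite cat_uniq !map_inj_uniq ?IH ?andbT //=; try by move=> u v /rcons_inj [].
by apply/hasPn => _ /mapP [u _ ->]; apply/mapP => -[v _ /rcons_inj []].
Qed.

(** * Counting the words of a given value *)

Definition nwords L x := size (words_of L x).

Lemma nwordsS L x : nwords L.+1 x = (nwords L x + nwords L (x - φ ^+ L))%N.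
Proof. by rewrite /nwords /= size_cat !size_map. Qed.

Lemma nwords_neg L x : x < 0 -> nwords L x = 0%N.
Proof.
move=> x0; case E: (words_of L x) => [|w s]; first by rewrite /nwords E.
have: w \in words_of L x by rewrite E inE eqxx.
by rewrite mem_words_of => /andP [_ /eqP wx]; move: x0; rewrite -wx ltNge word_val_ge0.
Qed.

(** The value of a word of length L is at most
1 + phi + ... + phi^(L-1) = phi^(L+1) - phi. *)
Lemma nwords_big L x : φ ^+ L.+1 <= x -> nwords L x = 0%N.
Proof.
elim: L x => [|L IH] x hx.
  rewrite /nwords /=; case: eqP => // x0.
  by move: hx; rewrite expr1 x0 leNgt phi_gt0.
rewrite nwordsS !IH //; first by move: hx; rewrite phiXSS; lra.
exact: le_trans (phiX_le (leqnSn _)) hx.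
Qed.

Lemma words_of_small L x : x < φ ^+ L ->
  words_of L.+1 x = [seq rcons w false | w <- words_of L x].
Proof.
move=> hx; have /size0nil e0 : nwords L (x - φ ^+ L) = 0%N.
  by rewrite nwords_neg ?subr_lt0.
by rewrite /= e0 cats0.
Qed.

Lemma nwords_small L x : x < φ ^+ L -> nwords L.+1 x = nwords L x.
Proof. by move=> hx; rewrite /nwords words_of_small ?size_map. Qed.

Lemma nwords_stable L M x : x < φ ^+ L -> (L <= M)%N -> nwords M x = nwords L x.
Proof.
move=> hx /subnK <-; elim: (M - L)%N => [|k IH] //.
rewrite addSn nwords_small //; apply: lt_le_trans hx (phiX_le _).
exact: leq_addl.
Qed.

Lemma nwords0 L : nwords L 0 = 1%N.
Proof.
elim: L => [|L IH]; first by rewrite /nwords /= eqxx.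
by rewrite nwords_small ?phiX_gt0.
Qed.

(** The position L+1 cannot stay empty below the term phi^(L+2), because the
lower positions are worth less than phi^(L+2); using it leaves phi^L, which is
either taken as the digit at position L or again passed on to lower ones. *)
Lemma nwords_top L x : 0 <= x ->
  nwords L.+2 (x + φ ^+ L.+2) = (nwords L x + nwords L (x + φ ^+ L))%N.
Proof.
move=> x0; rewrite nwordsS nwords_big; last lra.
rewrite add0n.
have -> : x + φ ^+ L.+2 - φ ^+ L.+1 = x + φ ^+ L by rewrite phiXSS; ring.
by rewrite nwordsS addnC; congr (nwords _ _ + _)%N; ring.
Qed.

Lemma nwords_phiX L : nwords L.+2 (φ ^+ L.+2) = (nwords L (φ ^+ L)).+1.
Proof. by have := @nwords_top L 0 (lexx _); rewrite !add0r nwords0 add1n. Qed.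

Lemma nwordsS_phiX L : nwords L.+1 (φ ^+ L) = (nwords L (φ ^+ L)).+1.
Proof. by rewrite nwordsS subrr nwords0 addn1. Qed.

(** * Words of Fibonacci value *)

Lemma fibSS n : fib n.+2 = (fib n.+1 + fib n)%N.
Proof. by []. Qed.

Lemma fib_phi n : φ ^+ n.+1 = (fib n.+1)%:R * φ + (fib n)%:R.
Proof.
elim: n => [|n IH]; first by rewrite expr1 /=; ring.
by rewrite exprS IH mulrDr fibSS natrD mulrCA -expr2 phi_sqr; ring.
Qed.

Lemma fib_bounds k : (φ ^+ k <= φ * (fib k.+1)%:R) && ((fib k.+1)%:R <= φ ^+ k).
Proof.
have p1 := phi_gt1.
elim/ltn_ind: k => -[|[|k]] IH.
- by rewrite expr0 /=; lra.
- by rewrite expr1 /=; lra.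
have /andP [a b] := IH k.+1 (ltnSn _).
have /andP [c d] := IH k (ltnW (ltnSn _)).
by rewrite phiXSS fibSS natrD mulrDr !lerD.
Qed.

(** The exponent n + s, with s free, keeps every digit position met in the
recursion on n nonnegative: for n >= 2 the leading 1 of the greedy word for this
value is at position 2(n-1) + s. *)
Definition scaled_fib n s : R := (fib n)%:R * φ ^+ (n + s).

Lemma scaled_fibSS n s :
  scaled_fib n.+2 s = scaled_fib n s + φ ^+ (n.*2 + s).+2.
Proof.
rewrite /scaled_fib.
have -> : (n.+2 + s = 2 + (n + s))%N by lia.
have -> : ((n.*2 + s).+2 = n.+2 + (n + s))%N by lia.
rewrite !exprD phi_sqr fib_phi !fibSS !natrD; ring.
Qed.

Lemma scaled_fib_ge k s : φ ^+ (k.*2 + s) <= scaled_fib k.+1 s.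
Proof.
have /andP [h _] := fib_bounds k.
rewrite /scaled_fib addSn exprS mulrA [_ * φ]mulrC.
have -> : (k.*2 + s = k + (k + s))%N by lia.
by rewrite exprD ler_pM2r ?phiX_gt0.
Qed.

Lemma scaled_fib_lt k s : scaled_fib k.+1 s < φ ^+ (k.*2 + s).+2.
Proof.
have /andP [_ h] := fib_bounds k.
have -> : ((k.*2 + s).+2 = k.+1 + (k.+1 + s))%N by lia.
rewrite exprD ltr_pM2r ?phiX_gt0 //.
exact: le_lt_trans h (phiX_ltS _).
Qed.

(** Here x < phi^(L+2) and y = x + phi^(L+4).  If the digit L+4 of y is taken, what
remains is x; otherwise [nwords_top] applies twice, and it stops there because
two copies of phi^L exceed what the positions below L can reach. *)
Lemma nwords_scaled_fib_step k s :
  let L := (k.*2 + s)%N in let x := scaled_fib k.+1 s in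
  let y := scaled_fib k.+3 s in
  nwords L.+4 y = (nwords L.+2 x + nwords L x)%N /\
  nwords L.+4.+2 y = (nwords L.+2 x + nwords L.+4 y)%N.
Proof.
move=> L x y.
have ylt : y = x + φ ^+ L.+4 by rewrite /y scaled_fibSS doubleS.
have xge : φ ^+ L <= x := scaled_fib_ge k s.
have xlt : x < φ ^+ L.+2 := scaled_fib_lt k s.
have L0 := phiX_gt0 L.
have L1 := phiX_gt0 L.+1.
split.
  rewrite ylt nwords_top; last lra.
  rewrite nwords_top; last lra.
  rewrite [nwords L (x + _)]nwords_big ?addn0 //.
  rewrite exprS; apply: (@le_trans _ _ (2 * φ ^+ L)); last lra.
  by rewrite ler_pM2r // ltW // phi_lt2.
have yl : y < φ ^+ L.+4.+1.
  rewrite ylt !phiXSS; move: xlt; rewrite phiXSS; have := phiX_ltS L; lra.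
rewrite nwords_small // nwordsS addnC; congr (_ + _)%N.
have -> : y - φ ^+ L.+4 = x by rewrite ylt; ring.
rewrite (@nwords_stable L.+2) //; lia.
Qed.

(** Both recurrences of [nwords_scaled_fib_step] are linear with the Fibonacci
coefficients, so the increments under s -> s + 2 only have to be known for the
values F_1 phi^(1+s) and F_2 phi^(2+s), which are powers of phi. *)
Lemma nwords_scaled_fib k s :
  let L := (k.*2 + s)%N in
  let x := scaled_fib k.+1 s in let y := scaled_fib k.+1 s.+2 in
  nwords L.+2 y = (nwords L x + fib k)%N /\
  nwords L.+4 y = (nwords L.+2 x + fib k.+1)%N.
Proof.
elim/ltn_ind: k => -[|[|k]] IH.
- have e t : scaled_fib 1 t = φ ^+ t.+1 by rewrite /scaled_fib mul1r.
  rewrite /= !add0n !e !nwordsS_phiX !nwords_phiX.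
  by rewrite nwords_big // nwords_big //; split; lia.
- have e t : scaled_fib 2 t = φ ^+ t.+2 by rewrite /scaled_fib mul1r.
  rewrite /= !add2n !e [nwords s.+4.+2 _]nwords_small ?phiX_ltS //.
  rewrite [nwords s.+4 (φ ^+ s.+2)]nwords_small ?phiX_ltS //.
  by rewrite !nwordsS_phiX !nwords_phiX; split; lia.
have [IH1 IH2] := IH k (ltnW (ltnSn _)).
have [] := nwords_scaled_fib_step k s; have [] := nwords_scaled_fib_step k s.+2.
cbv zeta; rewrite !addnS !doubleS !addSn in IH1 IH2 *.
by move=> -> -> -> ->; rewrite IH1 IH2 !fibSS; split; lia.
Qed.

(** * Knott words *)

Fixpoint knott_word (w : seq bool) : bool :=
  if w is b :: w' then
    if b then ~~ (nth false w' 0 && ~~ nth false w' 1) else knott_word w'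
  else true.

Fixpoint split_lowest (w : seq bool) : seq bool :=
  match w with
  | [::] => [::]
  | false :: w' => false :: split_lowest w'
  | true :: w' => [:: true, true, false & w']
  end.

Lemma split_lowest_inj : injective split_lowest.
Proof.
elim=> [|[] u IH] [|[] v] //= [].
  by move=> ->.
by move=> /IH ->.
Qed.

Lemma word_val_split w : word_val (split_lowest w) = φ ^+ 2 * word_val w.
Proof.
elim: w => [|[] w IH] /=; first by ring.
  have p := phi_sqr; ring: p.
rewrite IH; ring.
Qed.

Lemma split_lowestP w : word_val w != 0 ->
  (size (split_lowest w) == (size w).+2) && ~~ knott_word (split_lowest w).
Proof.
elim: w => [|[] w IH] /=; first by rewrite eqxx.
  by rewrite !eqxx.
by rewrite add0r mulf_eq0 negb_or => /andP [_ /IH].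
Qed.

(** The top digit 0 excludes the words whose only digits 1 are the two highest
ones: they violate the Knott condition through a 0 above the top digit, and come
from no other word. *)
Lemma split_lowest_surj w : ~~ knott_word (rcons w false) ->
  exists u, rcons w false = split_lowest u.
Proof.
elim: w => [|[] w IH] //=.
  case: w {IH} => [|[] [|[] w]] //= _; first by exists [:: true].
  by exists (true :: rcons w false).
by move=> /IH [u ->]; exists (false :: u).
Qed.

(** [split_lowest] multiplies values by phi^2, since 1 + phi = phi^2; the bound on
x forces the top digit 0 that [split_lowest_surj] asks for. *)
Lemma not_knott_words L x : 0 < x -> x < φ ^+ L ->
  perm_eq [seq w <- words_of L.+3 (φ ^+ 2 * x) | ~~ knott_word w]
          [seq split_lowest w | w <- words_of L.+1 x].
Proof.
move=> x0 xL; have p2 : φ ^+ 2 != 0 by rewrite gt_eqF ?phiX_gt0.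
apply: uniq_perm.
- by rewrite filter_uniq ?uniq_words_of.
- by rewrite map_inj_uniq ?uniq_words_of //; apply: split_lowest_inj.
move=> w; rewrite mem_filter; apply/andP/mapP => [[nk]|[u + ->]].
  rewrite words_of_small; last by rewrite -[L.+2]/(2 + L)%N exprD ltr_pM2l ?phiX_gt0.
  move=> /mapP [v + ew]; rewrite {w}ew in nk *.
  rewrite mem_words_of => /andP [/eqP sv /eqP vv].
  have [u eu] := split_lowest_surj nk; exists u => //.
  have := word_val_split u.
  rewrite -eu word_val_rcons vv mul0r addr0 => /(mulfI p2) ux.
  have u0 : word_val u != 0 by rewrite -ux gt_eqF.
  have /andP [/eqP su _] := split_lowestP u0.
  move: su; rewrite -eu size_rcons sv mem_words_of => -[<-].
  by rewrite -ux !eqxx.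
rewrite !mem_words_of => /andP [/eqP su /eqP uv].
have u0 : word_val u != 0 by rewrite uv gt_eqF.
have /andP [/eqP su' ->] := split_lowestP u0.
by rewrite su' su word_val_split uv !eqxx.
Qed.

Definition knott_words L x := [seq w <- words_of L x | knott_word w].

Lemma mem_knott_words L x w :
  (w \in knott_words L x) = [&& knott_word w, size w == L & word_val w == x].
Proof. by rewrite mem_filter mem_words_of. Qed.

Lemma size_knott_words L x : 0 < x -> x < φ ^+ L ->
  (size (knott_words L.+3 (φ ^+ 2 * x)) + nwords L.+1 x)%N =
  nwords L.+3 (φ ^+ 2 * x).
Proof.
move=> x0 xL; have /perm_size := not_knott_words x0 xL.
rewrite size_map size_filter => e.
by rewrite /nwords -e size_filter count_predC.
Qed.

(** By [size_knott_words] this number is the difference of two word counts, and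
[nwords_scaled_fib] computes the same difference for the smallest lengths that
leave no word out. *)
Lemma size_knott_fib k s L : ((k.*2 + s).+2 <= L)%N ->
  size (knott_words L.+3 (scaled_fib k.+1 s.+2)) = fib k.+1.
Proof.
move=> hL; have lt1 := scaled_fib_lt k s.
have ltL : scaled_fib k.+1 s < φ ^+ L := lt_le_trans lt1 (phiX_le hL).
have x0 : 0 < scaled_fib k.+1 s := lt_le_trans (phiX_gt0 _) (scaled_fib_ge k s).
have e : scaled_fib k.+1 s.+2 = φ ^+ 2 * scaled_fib k.+1 s.
  by rewrite /scaled_fib !addnS !exprS; ring.
have := size_knott_words x0 ltL; rewrite -e.
rewrite (nwords_stable lt1) ?(nwords_stable (scaled_fib_lt k s.+2)); try lia.
have [_] := nwords_scaled_fib k s; rewrite !addnS => ->; lia.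
Qed.

(** * From words to expansions *)

Definition digits (r : int) (w : seq bool) (i : int) : bool :=
  if i - r is Posz j then nth false w j else false.

Lemma digits_nat r w j : digits r w (r + j%:Z) = nth false w j.
Proof. by rewrite /digits addrAC subrr add0r. Qed.

Lemma digits_lt r w i : i < r -> digits r w i = false.
Proof. by rewrite /digits => h; case E: (i - r) => [j|j] //; lia. Qed.

Variant digits_spec (r : int) (w : seq bool) (i : int) : bool -> Prop :=
| DigitsLt of i < r : digits_spec r w i false
| DigitsGe j of i = r + j%:Z : digits_spec r w i (nth false w j).

Lemma digitsP r w i : digits_spec r w i (digits r w i).
Proof.
case: (ltP i r) => h; first by rewrite digits_lt //; left.
have -> : i = r + `|i - r|%N%:Z by lia.
by rewrite digits_nat; right.
Qed.

Lemma digits_cons r b w :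
  digits r (b :: w) = fun i => if i == r then b else digits (r + 1) w i.
Proof.
apply/funext => i; case: digitsP => [h|[|j] ->] /=.
- by rewrite digits_lt ?lt_eqF //; lia.
- by rewrite addr0 eqxx.
have -> : (r + j.+1%:Z == r) = false by lia.
have -> : r + j.+1%:Z = r + 1 + j%:Z by lia.
by rewrite digits_nat.
Qed.

Lemma digits_pad p q r w :
  digits (r - p%:Z) (nseq p false ++ w ++ nseq q false) = digits r w.
Proof.
apply/funext => i; case: digitsP => [h|j ->].
  by rewrite digits_lt //; lia.
rewrite nth_cat size_nseq; case: ltnP => h.
  by rewrite nth_nseq h digits_lt //; lia.
have -> : r - p%:Z + j%:Z = r + (j - p)%N%:Z by lia.
rewrite digits_nat nth_cat; case: ltnP => // h'.
by rewrite nth_nseq if_same nth_default.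
Qed.

Lemma digits_inj r u v : size u = size v -> digits r u = digits r v -> u = v.
Proof.
move=> es ed; apply: (@eq_from_nth _ false) => // j _.
by rewrite -(digits_nat r) ed digits_nat.
Qed.

Lemma word_val_sum w :
  word_val w = \sum_(j <- iota 0 (size w)) (nth false w j)%:R * φ ^+ j.
Proof.
elim/last_ind: w => [|w b IH]; first by rewrite big_nil.
rewrite word_val_rcons IH size_rcons -addn1 iotaD big_cat big_seq1 /= add0n.
rewrite nth_rcons ltnn eqxx; congr (_ + _).
rewrite !big_seq; apply: eq_bigr => j; rewrite mem_iota add0n /= => h.
by rewrite nth_rcons h.
Qed.

Lemma finite_support_digits r w : finite_set [set i | digits r w i].
Proof.
apply: (@sub_finite_set _ _ [set` [seq r + j%:Z | j <- iota 0 (size w)]]) => [i /=|].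
  case: digitsP => // j -> hj; apply/mapP; exists j => //.
  by rewrite mem_iota; case: ltnP => // h; rewrite nth_default in hj.
exact: finite_seq.
Qed.

Lemma digits_sum r w :
  \sum_(i \in [set: int]) (digits r w i)%:R * φ ^ i = φ ^ r * word_val w.
Proof.
have u : uniq [seq r + j%:Z | j <- iota 0 (size w)].
  by rewrite map_inj_uniq ?iota_uniq // => i j /addrI [].
rewrite (fsbigE [seq r + j%:Z | j <- iota 0 (size w)]) //; last first.
  move=> i _; case: digitsP => [|j ->] hi; first by rewrite mul0r.
  move/negP: hi; case: (ltnP j (size w)) => hj hi.
    by case: hi; apply/mapP; exists j; rewrite ?mem_iota.
  by rewrite nth_default ?mul0r.
rewrite big_map word_val_sum mulr_sumr; apply: eq_big => [j|j _].
  by rewrite in_setT.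
rewrite digits_nat expfzDr ?gt_eqF ?phi_gt0 //.
by rewrite -exprnP; ring.
Qed.

Lemma base_phi_expansion_digits N m w :
  base_phi_expansion R N (digits (- m%:Z) w) <-> word_val w = N%:R * φ ^+ m.
Proof.
have pm : φ ^+ m != 0 by rewrite gt_eqF ?phiX_gt0.
rewrite /base_phi_expansion digits_sum -invr_expz -exprnP.
split=> [[_ ->]|->]; first by rewrite mulrC mulrA divff ?mul1r.
by split; [exact: finite_support_digits | rewrite mulrC mulfK].
Qed.

(** The lowest position r0 has to vary in the induction: dropping a lowest digit 0
raises it by one. *)
Lemma knott_digits r0 w :
  (forall r, digits r0 w r -> (forall i, i < r -> digits r0 w i = false) ->
    (digits r0 w (r + 2), digits r0 w (r + 1), digits r0 w r)
      <> (false, true, true)) <-> knott_word w.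
Proof.
elim: w r0 => [|b w IH] r0.
  by split => // _ r; rewrite /digits; case: (r - r0) => // j; rewrite nth_nil.
case: b => /=.
  have d0 : digits r0 (true :: w) r0 by rewrite digits_cons eqxx.
  have d1 : digits r0 (true :: w) (r0 + 1) = nth false w 0 by rewrite digits_nat.
  have d2 : digits r0 (true :: w) (r0 + 2) = nth false w 1 by rewrite digits_nat.
  split=> [H|H r dr lo].
    move: (H r0 d0 (@digits_lt _ _)); rewrite d0 d1 d2.
    by case: nth => //; case: nth.
  have -> : r = r0.
    case: (ltgtP r r0) => // h; first by rewrite digits_lt in dr.
    by rewrite (lo _ h) in d0.
  rewrite d0 d1 d2; move: H.
  by case: nth => //; case: nth.
have e : digits r0 (false :: w) = digits (r0 + 1) w.
  rewrite digits_cons; apply/funext => i; case: eqP => // ->.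
  by rewrite digits_lt //; lia.
by rewrite e; apply: IH.
Qed.

Lemma knott_expansion_digits N m w :
  knott_expansion R N (digits (- m%:Z) w) <->
  knott_word w /\ word_val w = N%:R * φ ^+ m.
Proof.
rewrite /knott_expansion base_phi_expansion_digits knott_digits.
by split=> -[].
Qed.

Lemma support_bound (a : int -> bool) : finite_set [set i | a i] ->
  exists b : nat, forall i, a i -> (`|i| <= b)%N.
Proof.
move=> /finite_fsetP [X eX]; exists (\max_(i <- X) `|i|)%N => i ai.
have iX : i \in X by have : [set i | a i]%classic i by []; rewrite eX.
exact: (@leq_bigmax_seq _ (enum_fset X) xpredT (fun i : int => absz i) i iX isT).
Qed.

Lemma digits_mkseq (a : int -> bool) b m L :
  (forall i, a i -> (`|i| <= b)%N) -> (b <= m)%N -> (m + b < L)%N ->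
  a = digits (- m%:Z) (mkseq (fun j => a (- m%:Z + j%:Z)) L).
Proof.
move=> ha hm hL; apply/funext => i; case: digitsP => [h|j ->].
  by apply/negP => /ha; lia.
case: (ltnP j L) => hj; first by rewrite nth_mkseq.
rewrite nth_default ?size_mkseq //; apply/negP => /ha; lia.
Qed.

Lemma knott_word_pad p q w :
  knott_word (nseq p false ++ w ++ nseq q false) = knott_word w.
Proof.
elim: p => [|p IH] //=; elim: w => [|[] w IH] //=; first by elim: q.
by case: w {IH} => [|b [|c w]] /=; case: q => [|[|q]].
Qed.

Lemma word_val_pad p q w :
  word_val (nseq p false ++ w ++ nseq q false) = φ ^+ p * word_val w.
Proof. by rewrite !word_val_cat !word_val_nseq0 size_nseq mulr0 addr0 add0r. Qed.

(** Padding with zeros below and above is injective and keeps Knott words Knott;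
both sides have F_(k+1) elements by [size_knott_fib], so no other Knott word
appears when more positions are allowed. *)
Lemma knott_words_pad k p q L : (k.*2.+2 <= L)%N ->
  knott_words (p + (L.+3 + q)) (scaled_fib k.+1 (p + 2)) =i
  [seq nseq p false ++ w ++ nseq q false
  | w <- knott_words L.+3 (scaled_fib k.+1 2)].
Proof.
move=> hL; set K := knott_words _ _; set K0 := knott_words _ _.
set pad := fun w : seq bool => _.
have pad_inj : injective pad.
  move=> u v /eqP; rewrite eqseq_cat // eqxx /= => /eqP /(congr1 rev).
  by rewrite !rev_cat => /eqP; rewrite eqseq_cat // eqxx => /eqP /(inv_inj (@revK _)).
have uK0 : uniq [seq pad w | w <- K0].
  by rewrite map_inj_uniq // filter_uniq ?uniq_words_of.
have sub : {subset [seq pad w | w <- K0] <= K}.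
  move=> _ /mapP [w + ->]; rewrite !mem_knott_words knott_word_pad word_val_pad.
  move=> /and3P [-> /eqP sw /eqP ->]; rewrite !size_cat !size_nseq sw eqxx /=.
  by apply/eqP; rewrite /scaled_fib addnCA [in RHS]exprD mulrCA.
have sK : (size K <= size [seq pad w | w <- K0])%N.
  rewrite size_map /K /K0 addnA addnS addnS addnS !addSn addn2.
  rewrite size_knott_fib; last lia.
  by rewrite size_knott_fib ?addn0.
by move=> w; have [_ ->] := uniq_min_size uK0 sub sK.
Qed.

(** A Knott expansion has bounded support, hence is a Knott word of some length,
and [knott_words_pad] removes the superfluous positions. *)
Lemma knott_expansionsE k L : (k.*2.+2 <= L)%N ->
  [set a | knott_expansion R (fib k.+1) a] =
  digits (- k.+3%:Z) @` [set` knott_words L.+3 (scaled_fib k.+1 2)].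
Proof.
move=> hL; apply/seteqP; split=> [a /= Ka|_ /= [w + <-]]; last first.
  rewrite mem_knott_words => /and3P [kw _ /eqP vw].
  by apply/knott_expansion_digits; rewrite vw /scaled_fib addSn addn2.
have [b hb] := support_bound Ka.1.1.
(* The length is written as the padding lemma wants it; the second b + k.+3 pads
   the top, so that all positions up to b are covered. *)
have ea := @digits_mkseq a b (k.+3 + b) (b + (L.+3 + (b + k.+3))) hb.
rewrite ea in Ka *; try lia; set w := mkseq _ _ in Ka *.
have [kw vw] := (knott_expansion_digits _ _ _).1 Ka.
have : w \in knott_words (b + (L.+3 + (b + k.+3))) (scaled_fib k.+1 (b + 2)).
  rewrite mem_knott_words kw size_mkseq eqxx vw /scaled_fib /=.
  by have -> : (k.+1 + (b + 2) = k.+3 + b)%N by lia.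
rewrite knott_words_pad // => /mapP [u hu ->]; exists u => //.
by rewrite PoszD opprD digits_pad.
Qed.
End Words.

(** * Knott expansions of Fibonacci numbers *)

Theorem theorem3p2 (R : realType) (n : nat) (hn : (1 <= n)%N) :
  Tot_kappa R (fib n) = fib n.
Proof.
case: n hn => // k _; set L := k.*2.+2.
have uK : uniq (knott_words L.+3 (scaled_fib R k.+1 2)).
  by rewrite filter_uniq ?uniq_words_of.
rewrite /Tot_kappa (@knott_expansionsE R k L) // fset_set_image; last first.
  exact: finite_seq.
rewrite card_in_imfset /=; last first.
  move=> u v; rewrite !in_fset_set; try exact: finite_seq.
  rewrite !inE /= !mem_knott_words => /and3P [_ /eqP su _] /and3P [_ /eqP sv _].
  by apply: digits_inj; rewrite su sv.
apply: etrans (@size_knott_fib R k 0 L _); last by rewrite addn0.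
apply/perm_size/uniq_perm => [|//|w]; first exact: fset_uniq.
by rewrite in_fset_set ?mem_setE //; exact: finite_seq.
Qed.
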